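(* Let $p$ be a prime number and let $f\in\mathbb{Z}[\alpha][x]$, $f=f_1+\alpha f_2$ with $f_1,f_2\in\mathbb{Z}[x]$. Then the following statements are equivalent: (1) $f$ is a permutation polynomial on $\mathbb{Z}_{p^n}[\alpha]$ for all $n\ge1$; (2) $f$ is a permutation polynomial on $\mathbb{Z}_{p^n}[\alpha]$ for some $n\ge1$; (3) $f_1$ is a permutation polynomial on $\mathbb{Z}_{p^n}[\alpha]$ for all $n\ge1$; (4) $f_1$ is a permutation polynomial on $\mathbb{Z}_{p^n}[\alpha]$ for some $n\ge1$; (5) $f_1$ is a permutation polynomial on $\mathbb{Z}_p$ and for all $a\in\mathbb{Z}$, $f_1'(a)\not\equiv0\pmod p$; (6) $f_1$ is a permutation polynomial on $\mathbb{Z}_{p^n}$ for all $n\ge1$; (7) $f_1$ is a permutation polynomial on $\mathbb{Z}_{p^n}$ for some $n>1$.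
   Context: $\mathbb{Z}_m=\mathbb{Z}/m\mathbb{Z}$. For a commutative ring $R$ with $1$, the ring of dual numbers over $R$ is $R[\alpha]=R[x]/(x^2)$, where $\alpha=x+(x^2)$; so every element is uniquely $a+b\alpha$ with $a,b\in R$, and $\alpha^2=0$. If $S$ is a commutative ring and $A$ a commutative $S$-algebra, then $f\in S[x]$ induces a function on $A$ by substitution, and $f$ is called a permutation polynomial on $A$ if this function is a bijection of $A$; here $\mathbb{Z}_{p^n}$ and $\mathbb{Z}_{p^n}[\alpha]$ are regarded as $\mathbb{Z}$-algebras and $\mathbb{Z}_{p^n}[\alpha]$ as a $\mathbb{Z}[\alpha]$-algebra via reduction modulo $p^n$. $f'$ denotes the formal derivative. *)

(* Defs.v *)
From HB Require Import structures.
From mathcomp Require Import all_boot all_order all_algebra.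

Set Implicit Arguments.
Unset Strict Implicit.
Unset Printing Implicit Defensive.

Import GRing.Theory Pdiv.CommonRing Pdiv.RingMonic.
Local Open Scope ring_scope.

(* The ring of dual numbers R[x]/(x^2), with alpha the class of x, and the    *)
(* embedding of R as the constants. 'X^2 is monic of size 3 > 1, so that      *)
(* {poly %/ 'X^2} is the quotient by 'X^2 itself (see mk_monic_Xn).           *)
Notation dual R := {poly %/ ('X^2 : {poly R})}.
Notation alpha R := (qpolyX ('X^2 : {poly R})).
Notation dualC R := (qpolyC ('X^2 : {poly R})).

Section DualMap.

Variables (S R : comNzRingType) (phi : {rmorphism S -> R}).

(* The map a + b alpha |-> phi a + phi b alpha. *)
Definition dual_map (z : dual S) : dual R :=
  in_qpoly 'X^2 (map_poly phi (z : {poly S})).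

Fact dual_map_is_zmod_morphism : zmod_morphism dual_map.
Proof. by move=> y z; rewrite /dual_map !raddfB. Qed.

Fact in_qpoly_map_rmodp (q : {poly S}) :
  in_qpoly 'X^2 (map_poly phi (rmodp q 'X^2)) =
  in_qpoly 'X^2 (map_poly phi q) :> dual R.
Proof.
rewrite [q in RHS](rdivp_eq (monicXn S 2)).
rewrite rmorphD rmorphM /= map_polyXn in_qpolyD in_qpolyM.
suff -> : in_qpoly 'X^2 'X^2 = 0 :> dual R by rewrite mulr0 add0r.
by apply: val_inj; rewrite /= mk_monic_Xn rmodpp ?monicXn.
Qed.

Fact dual_map_is_monoid_morphism : monoid_morphism dual_map.
Proof.
split=> [|y z]; first by rewrite /dual_map [polyn _]/= rmorph1 in_qpoly1.
rewrite /dual_map poly_of_qpolyM [X in rmodp _ X]mk_monic_Xn.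
by rewrite in_qpoly_map_rmodp rmorphM in_qpolyM.
Qed.

HB.instance Definition _ :=
  GRing.isZmodMorphism.Build (dual S) (dual R) dual_map
    dual_map_is_zmod_morphism.
HB.instance Definition _ :=
  GRing.isMonoidMorphism.Build (dual S) (dual R) dual_map
    dual_map_is_monoid_morphism.

End DualMap.

(* The commutative S-algebra A is given by its structure morphism phi. *)
Definition perm_poly (S A : comNzRingType) (phi : {rmorphism S -> A})
    (f : {poly S}) : Prop :=
  bijective (fun a : A => (map_poly phi f).[a]).

Definition perm_polyZ (A : comNzRingType) (f : {poly int}) : Prop :=
  perm_poly (intr : {rmorphism int -> A}) f.

Definition perm_poly_dualZ (R : comNzRingType) (f : {poly dual int}) : Prop :=
  perm_poly (dual_map (intr : {rmorphism int -> R})) f.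

(* Main.v *)
Require Import Defs.
From mathcomp Require Import all_boot all_order all_algebra.
From mathcomp Require Import ring.

Set Implicit Arguments.
Unset Strict Implicit.
Unset Printing Implicit Defensive.

Import GRing.Theory.
Local Open Scope ring_scope.

(** Since [alpha ^ 2 = 0], Taylor's formula gives
    [f (a + b alpha) = f1 a + (b f1'(a) + f2 a) alpha], so that [f] permutes
    the dual numbers over a finite ring if and only if [f1] permutes the ring
    and [f1'] takes only unit values; [f2] plays no role.  Over [Z / p^n] the
    second condition says that [f1'] has no zero modulo [p].  Under it, a
    permutation modulo [p] lifts to all [p^n] by Hensel's argument: if
    [y = x + p^n t], then [f1 y - f1 x = p^n t f1'(x)] modulo [p^(n+1)].  It
    follows from being a permutation modulo [p^n] with [n > 1]: if [p] divides
    [f1'(a)], then [f1] takes the same value at [a] and [a + p^(n-1)]. *)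

(** A right inverse [g] of [f] is injective, hence bijective by finiteness, and [f] is then its
    two-sided inverse. *)
Lemma surjF_bij (T : finType) (f : T -> T) :
  (forall y, exists x, f x = y) -> bijective f.
Proof.
move=> /fin_all_exists[g gK]; have [h hK gK'] := injF_bij (can_inj gK).
by exists g => // x; rewrite -(gK' x) gK.
Qed.

(** An existential remainder avoids halving the second derivative, so that the formula makes sense
    over every commutative ring. *)
Lemma horner_taylor2 (R : comNzRingType) (q : {poly R}) (x h : R) :
  exists c, q.[x + h] = q.[x] + h * q^`().[x] + h ^+ 2 * c.
Proof.
elim/poly_ind: q => [|q a [c qE]].
  by exists 0; rewrite deriv0 !horner0 !mulr0 !addr0.
exists (q^`().[x] + c * (x + h)).
rewrite derivD derivC addr0 derivM derivX mulr1 !hornerE qE; ring.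
Qed.

(** * Dual numbers in coordinates *)

Section DualNumbers.

Variable R : comNzRingType.

Definition mkdual (a b : R) : dual R := dualC R a + alpha R * dualC R b.

Lemma polyn_mkdual (a b : R) : mkdual a b = a%:P + 'X * b%:P :> {poly R}.
Proof.
have small (q : {poly R}) : (size q <= 2)%N ->
    in_qpoly ('X^2 : {poly R}) q = q :> {poly R}.
  by move=> le_q2; apply: in_qpoly_small; rewrite mk_monic_Xn size_polyXn.
have polyCE c : dualC R c = in_qpoly ('X^2) c%:P.
  by apply/val_inj/esym/small; apply: leq_trans (size_polyC_leq1 _) _.
rewrite /mkdual !polyCE -in_qpolyM -in_qpolyD small // addrC mulrC.
by rewrite size_MXaddC; case: ifP => // _; rewrite ltnS size_polyC_leq1.
Qed.

Lemma mkdual_inj (a b a' b' : R) :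
  mkdual a b = mkdual a' b' -> a = a' /\ b = b'.
Proof.
move=> /(congr1 (fun z : dual R => (z : {poly R}))); rewrite !polyn_mkdual.
move=> eq_p; split.
  by move/(congr1 (coefp 0)): eq_p; rewrite /= !coefD !coefC !coefXM !addr0.
move/(congr1 (coefp 1)): eq_p.
by rewrite /= !coefD !coefC !coefXM !coefC !add0r.
Qed.

Lemma mkdual_ex (z : dual R) : exists a b, z = mkdual a b.
Proof.
exists (z : {poly R})`_0, (z : {poly R})`_1; apply: val_inj.
rewrite [RHS]polyn_mkdual.
apply/polyP=> -[|[|i]]; rewrite !coefD !coefC !coefXM !coefC ?addr0 ?add0r //=.
rewrite nth_default //; apply: leq_trans (size_npoly z) _.
by rewrite mk_monic_Xn size_polyXn.
Qed.

Lemma alpha_sqr : alpha R ^+ 2 = 0.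
Proof.
rewrite -[LHS](rmorphXn (in_qpoly ('X^2 : {poly R}))); apply: val_inj => /=.
by rewrite mk_monic_Xn Pdiv.RingMonic.rmodpp ?monicXn.
Qed.

Lemma horner_mkdual (g k : {poly R}) (a b : R) :
  (map_poly (dualC R) g + alpha R *: map_poly (dualC R) k).[mkdual a b] =
  mkdual g.[a] (b * g^`().[a] + k.[a]).
Proof.
rewrite hornerD hornerZ {1 2}/mkdual.
have [c ->] := horner_taylor2 (map_poly (dualC R) g) (dualC R a)
  (alpha R * dualC R b).
have [d ->] := horner_taylor2 (map_poly (dualC R) k) (dualC R a)
  (alpha R * dualC R b).
rewrite !deriv_map !horner_map exprMn alpha_sqr !mul0r !addr0.
(* The linear term of [k] vanishes as well, since the outer factor [alpha R] makes it a multiple of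
   [alpha R ^+ 2]. *)
rewrite /mkdual rmorphD rmorphM /= mulrDr !mulrA -expr2 alpha_sqr !mul0r addr0.
by rewrite mulrDr addrA mulrA.
Qed.

End DualNumbers.

Lemma dual_bijE (R : finComUnitRingType) (g k : {poly R}) :
  bijective (fun z : dual R =>
    (map_poly (dualC R) g + alpha R *: map_poly (dualC R) k).[z]) <->
  bijective (horner g) /\ (forall a, g^`().[a] \is a GRing.unit).
Proof.
split=> [[F' F'K FK'] | [[g' g'K gK'] g_unit]].
  have surj c d : exists a b, g.[a] = c /\ b * g^`().[a] + k.[a] = d.
    have [a [b F'E]] := mkdual_ex (F' (mkdual c d)); exists a, b.
    by apply: mkdual_inj; rewrite -horner_mkdual -F'E FK'.
  have g_bij : bijective (horner g).
    apply: surjF_bij => c; have [a [_ [ga _]]] := surj c 0.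
    by exists a.
  split=> // a; have [a' [b [/(bij_inj g_bij)-> /addIr bE]]] :=
    surj g.[a] (1 + k.[a]).
  by apply/unitrPr; exists b; rewrite mulrC.
have F_inj : injective (fun z : dual R =>
    (map_poly (dualC R) g + alpha R *: map_poly (dualC R) k).[z]).
  move=> z z'; have [a [b ->]] := mkdual_ex z; have [a' [b' ->]] := mkdual_ex z'.
  rewrite !horner_mkdual => /mkdual_inj[/(can_inj g'K)-> /addIr].
  by move/(mulIr (g_unit a'))->.
(* The dual numbers are taken here as the polynomials of size at most 2, which form a finite
   type. *)
exact: (@injF_bij {poly_(size (mk_monic ('X^2 : {poly R}))).-1 R}).
Qed.

(** * Residue rings and divisibility of integers *)

Lemma intZp_eq0 (m : nat) (z : int) : (1 < m)%N ->
  (z%:~R == 0 :> 'Z_m) = (m %| z)%Z.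
Proof.
move=> m_gt1; have natE k : (k%:R == 0 :> 'Z_m) = (m %| k)%N.
  (* ['Z_m] has modulus [m] only for [m > 1]; for [m = 0] and [m = 1] its modulus is 2. *)
  by rewrite -val_eqE /= val_Zp_nat.
by case: z => k; rewrite ?NegzE ?rmorphN ?oppr_eq0 ?dvdzN natE.
Qed.

Lemma intZp_eq (m : nat) (x y : int) : (1 < m)%N ->
  (x%:~R == y%:~R :> 'Z_m) = (m %| x - y)%Z.
Proof. by move=> m_gt1; rewrite -subr_eq0 -rmorphB intZp_eq0. Qed.

Lemma Zp_int_ex (m : nat) (c : 'Z_m) : exists z : int, c = z%:~R.
Proof. by exists (c : nat)%:Z; rewrite -pmulrn natr_Zp. Qed.

Lemma intZp_unit (p n : nat) (z : int) : prime p -> (0 < n)%N ->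
  (z%:~R : 'Z_(p ^ n)%N) \is a GRing.unit = ~~ (p %| z)%Z.
Proof.
move=> p_prime n_gt0; have pn_gt1 : (1 < p ^ n)%N.
  by rewrite -(exp1n n) ltn_exp2r ?prime_gt1.
have natE k : (k%:R : 'Z_(p ^ n)%N) \is a GRing.unit = ~~ (p %| k)%N.
  by rewrite unitZpE // coprime_pexpl // prime_coprime.
by case: z => k; rewrite ?NegzE ?rmorphN ?unitrN ?dvdzN natE.
Qed.

Lemma perm_polyZ_inj (m : nat) (f : {poly int}) : (1 < m)%N ->
  perm_polyZ 'Z_m f <->
  (forall x y : int, (m %| f.[x] - f.[y])%Z -> (m %| x - y)%Z).
Proof.
move=> m_gt1; split=> [/bij_inj f_inj x y | f_inj].
  rewrite -!intZp_eq // -!horner_map => /eqP/f_inj->.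
  exact: eqxx.
apply: injF_bij => a b; have [x ->] := Zp_int_ex a; have [y ->] := Zp_int_ex b.
rewrite !horner_map => /eqP; rewrite intZp_eq // => /f_inj.
by rewrite -intZp_eq // => /eqP.
Qed.

(** Finiteness makes surjectivity sufficient, and in this form the property passes at once to a
    divisor of the modulus. *)
Lemma perm_polyZ_surj (m : nat) (f : {poly int}) : (1 < m)%N ->
  perm_polyZ 'Z_m f <-> (forall c : int, exists x, (m %| f.[x] - c)%Z).
Proof.
move=> m_gt1; split=> [[f' _ fK] c | f_surj].
  have [x xE] := Zp_int_ex (f' c%:~R); exists x.
  by rewrite -intZp_eq // -(fK c%:~R) xE horner_map.
apply: surjF_bij => c; have [z ->] := Zp_int_ex c.
have [x] := f_surj z; rewrite -intZp_eq // => /eqP xE.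
by exists x%:~R; rewrite horner_map.
Qed.

Lemma perm_polyZ_dvd (m M : nat) (f : {poly int}) :
  (1 < m)%N -> (1 < M)%N -> (m %| M)%N ->
  perm_polyZ 'Z_M f -> perm_polyZ 'Z_m f.
Proof.
move=> m_gt1 M_gt1 dv_mM /(perm_polyZ_surj _ M_gt1) f_surj.
apply/perm_polyZ_surj => // c; have [x dv_M] := f_surj c.
by exists x; apply: dvdz_trans dv_M.
Qed.

(** * Descent and lifting between powers of a prime *)

Section PrimePowers.

Variables (p : nat) (f : {poly int}).
Hypothesis p_prime : prime p.

Let pX_gt1 n : (0 < n)%N -> (1 < p ^ n)%N.
Proof. by move=> n_gt0; rewrite -(exp1n n) ltn_exp2r ?prime_gt1. Qed.

Lemma perm_polyZ_prime n : (0 < n)%N ->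
  perm_polyZ 'Z_(p ^ n)%N f -> perm_polyZ 'Z_p f.
Proof.
move=> n_gt0; apply: perm_polyZ_dvd; rewrite ?pX_gt1 ?prime_gt1 //.
exact: dvdn_exp.
Qed.

Lemma perm_polyZ_lift n : (0 < n)%N -> perm_polyZ 'Z_p f ->
    (forall a : int, ~~ (p %| f^`().[a])%Z) ->
  perm_polyZ 'Z_(p ^ n)%N f.
Proof.
move=> n_gt0 f_perm f'_neq0; elim: n n_gt0 => // -[|n] IHn _.
  by rewrite expn1.
apply/perm_polyZ_inj => [|x y]; rewrite ?pX_gt1 //.
have /perm_polyZ_inj/(_ x y) := IHn isT; rewrite pX_gt1 // => /(_ isT) IHxy.
move=> dv_f; have /IHxy/dvdzP[t xyE] : ((p ^ n.+1)%N %| f.[x] - f.[y])%Z.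
  by apply: dvdz_trans dv_f; apply: dvdn_exp2l.
have [c] := horner_taylor2 f y (x - y); rewrite addrC subrK => fxE.
have pX_neq0 : (p ^ n.+1)%N%:Z != 0.
  by rewrite -lt0n expn_gt0 prime_gt0.
move: dv_f; rewrite fxE addrAC [f.[y] + _]addrC addrK xyE.
rewrite (expnS p n.+1) PoszM [X in _ -> is_true X]dvdz_mul2r //.
suff -> : t * (p ^ n.+1)%N * f^`().[y] + (t * (p ^ n.+1)%N) ^+ 2 * c =
          (t * f^`().[y] + p%:Z * (t ^+ 2 * (p ^ n)%N%:Z * c)) * (p ^ n.+1)%N.
  rewrite dvdz_mul2r // rpredDr; last exact: dvdz_mulr.
  rewrite !dvdzE abszM Euclid_dvdM //.
  by case/orP=> // dv_f'; case/negP: (f'_neq0 y); rewrite dvdzE.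
rewrite expnS PoszM; ring.
Qed.

Lemma perm_polyZ_deriv n : (1 < n)%N -> perm_polyZ 'Z_(p ^ n)%N f ->
  forall a : int, ~~ (p %| f^`().[a])%Z.
Proof.
case: n => [|[|n]] // _ /perm_polyZ_inj; rewrite pX_gt1 // => /(_ isT) f_inj a.
apply/negP => /dvdzP[u f'E].
have [c fE] := horner_taylor2 f a (p ^ n.+1)%N%:Z.
have /f_inj : ((p ^ n.+2)%N %| f.[a + (p ^ n.+1)%N%:Z] - f.[a])%Z.
  apply/dvdzP; exists (u + (p ^ n)%N%:Z * c).
  rewrite fE f'E (expnS p n.+1) (expnS p n) !PoszM; ring.
rewrite addrAC subrr add0r dvdzE /= dvdn_Pexp2l ?prime_gt1 //.
by rewrite ltnn.
Qed.

(** Every residue comes from an integer, so the unit condition can be tested on integers. The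
    arbitrary [k] covers both [f1 + alpha f2] and, with [k = 0], [f1] alone. *)
Lemma perm_poly_dual_pX n (k : {poly 'Z_(p ^ n)%N}) : (0 < n)%N ->
  bijective (fun z : dual 'Z_(p ^ n)%N =>
    (map_poly (dualC _) (map_poly intr f) + alpha _ *: map_poly (dualC _) k).[z])
  <-> perm_polyZ 'Z_(p ^ n)%N f /\ (forall a : int, ~~ (p %| f^`().[a])%Z).
Proof.
move=> n_gt0; rewrite dual_bijE; split=> -[f_perm f'_unit]; split=> // a.
  rewrite -(intZp_unit _ p_prime n_gt0) -horner_map -deriv_map.
  exact: f'_unit.
have [z ->] := Zp_int_ex a.
by rewrite deriv_map horner_map intZp_unit.
Qed.

End PrimePowers.

(** * Reduction of the coefficients *)

Lemma perm_polyZ_dualE (R : comNzRingType) (f : {poly int}) :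
  perm_polyZ (dual R) f <->
  bijective (fun z : dual R => (map_poly (dualC R) (map_poly intr f) +
                                alpha R *: map_poly (dualC R) 0).[z]).
Proof.
rewrite rmorph0 scaler0 addr0 -map_poly_comp.
rewrite (eq_map_poly (_ : dualC R \o intr =1 intr)) // => z.
exact: rmorph_int.
Qed.

Lemma dual_map_alpha (S R : comNzRingType) (phi : {rmorphism S -> R}) :
  dual_map phi (alpha S) = alpha R.
Proof.
have -> : alpha R = dual_map phi (in_qpoly 'X^2 'X).
  by rewrite /dual_map qpolyXE ?size_polyXn ?monicXn // map_polyX.
by [].
Qed.

Lemma dual_mapC (S R : comNzRingType) (phi : {rmorphism S -> R}) (a : S) :
  dual_map phi (dualC S a) = dualC R (phi a).
Proof.
apply: val_inj; rewrite /dual_map qpolyCE map_polyC [LHS]in_qpoly_small //.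
by apply: leq_ltn_trans (size_polyC_leq1 _) _; rewrite mk_monic_Xn size_polyXn.
Qed.

(** Reduction sends [alpha int] to [alpha R] and commutes with the embedding of constants, so it
    acts on [f1] and [f2] separately. *)
Lemma perm_poly_dualZE (R : comNzRingType) (f1 f2 : {poly int}) :
  perm_poly_dualZ R
    (map_poly (dualC int) f1 + alpha int *: map_poly (dualC int) f2) <->
  bijective (fun z : dual R => (map_poly (dualC R) (map_poly intr f1) +
    alpha R *: map_poly (dualC R) (map_poly intr f2)).[z]).
Proof.
rewrite /perm_poly_dualZ /perm_poly rmorphD /= map_polyZ /= dual_map_alpha.
rewrite -!map_poly_comp.
by rewrite !(eq_map_poly (_ : _ \o dualC int =1 dualC R \o intr)) // => z;
   rewrite /= dual_mapC.
Qed.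

Theorem theorem6p2 (p : nat) (p_prime : prime p)
    (f : {poly dual int}) (f1 f2 : {poly int})
    (fE : f = map_poly (dualC int) f1 + alpha int *: map_poly (dualC int) f2) :
  [<-> (* 1 *) forall n : nat, (1 <= n)%N ->
         perm_poly_dualZ 'Z_(p ^ n)%N f;
       (* 2 *) exists2 n : nat, (1 <= n)%N &
         perm_poly_dualZ 'Z_(p ^ n)%N f;
       (* 3 *) forall n : nat, (1 <= n)%N ->
         perm_polyZ (dual 'Z_(p ^ n)%N) f1;
       (* 4 *) exists2 n : nat, (1 <= n)%N &
         perm_polyZ (dual 'Z_(p ^ n)%N) f1;
       (* 5 *) perm_polyZ 'Z_p f1 /\
         (forall a : int, (f1^`().[a] != 0 %[mod p])%Z);
       (* 6 *) forall n : nat, (1 <= n)%N ->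
         perm_polyZ 'Z_(p ^ n)%N f1;
       (* 7 *) exists2 n : nat, (1 < n)%N &
         perm_polyZ 'Z_(p ^ n)%N f1].
Proof.
have dvdE a : (f1^`().[a] != 0 %[mod p])%Z = ~~ (p %| f1^`().[a])%Z.
  by rewrite eqz_mod_dvd subr0.
have dualfE n : (0 < n)%N -> perm_poly_dualZ 'Z_(p ^ n)%N f <->
    perm_polyZ 'Z_(p ^ n)%N f1 /\ (forall a : int, ~~ (p %| f1^`().[a])%Z).
  by move=> n_gt0; rewrite fE perm_poly_dualZE perm_poly_dual_pX.
have dualf1E n : (0 < n)%N -> perm_polyZ (dual 'Z_(p ^ n)%N) f1 <->
    perm_polyZ 'Z_(p ^ n)%N f1 /\ (forall a : int, ~~ (p %| f1^`().[a])%Z).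
  by move=> n_gt0; rewrite perm_polyZ_dualE perm_poly_dual_pX.
tfae.
- by move=> f_perm; exists 1%N => //; apply: f_perm.
(* The derivative condition is independent of the exponent, so it suffices to descend from [p ^ n]
   to [p] and lift to [p ^ m]. *)
- case=> n n_gt0 /(dualfE n n_gt0)[f1_perm f1'_neq0] m m_gt0.
  apply/dualf1E => //; split=> //; apply: perm_polyZ_lift => //.
  exact: perm_polyZ_prime f1_perm.
- by move=> f1_perm; exists 1%N => //; apply: f1_perm.
- case=> n n_gt0 /(dualf1E n n_gt0)[f1_perm f1'_neq0].
  by split=> [|a]; [apply: perm_polyZ_prime f1_perm | rewrite dvdE].
- case=> f1_perm f1'_neq0 n n_gt0; apply: perm_polyZ_lift => // a.
  by rewrite -dvdE.
- by move=> f1_perm; exists 2%N => //; apply: f1_perm.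
(* This closes the cycle, from (7) back to (1): [n > 1] yields the derivative condition, after which
   descent and lifting apply again. *)
case=> n n_gt1 f1_perm m m_gt0; apply/dualfE => //.
have f1'_neq0 := perm_polyZ_deriv p_prime n_gt1 f1_perm.
split=> //; apply: perm_polyZ_lift => //.
by apply: perm_polyZ_prime f1_perm => //; apply: ltnW.
Qed.
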